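(* There is a locally countable partial order $(P,\leq_P)$ of size continuum and height three with the following properties: (1) the first level $P_1$ of $P$ has size continuum; (2) if $f$ is any function from $P$ into the Turing degrees such that the image of $f$ on $P_1$ contains a perfect set (i.e. there is a perfect set $A\subseteq 2^\omega$ such that the Turing degree of every element of $A$ lies in $f(P_1)$), then $f$ is not an embedding.
   Context: A partial order $(P,\leq_P)$ is locally countable if every element has at most countably many strict predecessors. It has height $n$ if its longest chain has length exactly $n$. For a partial order of finite height, its first level consists of the elements with no strict predecessors, its second level consists of the elements not in the first level all of whose strict predecessors lie in the first level, and its third level consists of elements not in the first two levels all of whose strict predecessors lie in the first two levels. An embedding into the Turing degrees is a map $f$ with $x\leq_P y\iff f(x)\leq_T f(y)$ for all $x,y\in P$. A perfect set is a nonempty closed subset of $2^\omega$ without isolated points. *)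

(* Defs.v *)
From Stdlib Require Import List Arith.
Import ListNotations.

(** * Oracle partial recursive functionals (Kleene), used to define Turing reducibility *)
Inductive code : Type :=
| Zero : code
| Succ : code
| Proj : nat -> code
| Orc : code
| Comp : code -> list code -> code
| Prec : code -> code -> code
| Mu : code -> code.

Definition b2n (b : bool) : nat := if b then 1 else 0.

Inductive eval (o : nat -> bool) : code -> list nat -> nat -> Prop :=
| eZero v : eval o Zero v 0
| eSucc x v : eval o Succ (x :: v) (S x)
| eProj i v : i < length v -> eval o (Proj i) v (nth i v 0)
| eOrc x v : eval o Orc (x :: v) (b2n (o x))
| eComp f gs v ws y : evals o gs v ws -> eval o f ws y -> eval o (Comp f gs) v y
| ePrec0 f g v y : eval o f v y -> eval o (Prec f g) (0 :: v) y
| ePrecS f g n v r y :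
    eval o (Prec f g) (n :: v) r -> eval o g (n :: r :: v) y ->
    eval o (Prec f g) (S n :: v) y
| eMu f v n :
    eval o f (n :: v) 0 ->
    (forall m, m < n -> exists k, eval o f (m :: v) (S k)) ->
    eval o (Mu f) v n
with evals (o : nat -> bool) : list code -> list nat -> list nat -> Prop :=
| esNil v : evals o [] v []
| esCons g gs v y ys : eval o g v y -> evals o gs v ys -> evals o (g :: gs) v (y :: ys).

Definition turing_le (x y : nat -> bool) : Prop :=
  exists c : code, forall n, eval y c [n] (b2n (x n)).

Definition turing_eq (x y : nat -> bool) : Prop := turing_le x y /\ turing_le y x.

Definition agree_upto (n : nat) (x y : nat -> bool) : Prop :=
  forall k, k < n -> x k = y k.

Definition closed_set (A : (nat -> bool) -> Prop) : Prop :=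
  forall x, (forall n, exists y, A y /\ agree_upto n x y) -> A x.

Definition no_isolated (A : (nat -> bool) -> Prop) : Prop :=
  forall x, A x -> forall n, exists y, A y /\ y <> x /\ agree_upto n x y.

Definition perfect_set (A : (nat -> bool) -> Prop) : Prop :=
  (exists x, A x) /\ closed_set A /\ no_isolated A.

Definition partial_order {P : Type} (le : P -> P -> Prop) : Prop :=
  (forall x, le x x) /\
  (forall x y, le x y -> le y x -> x = y) /\
  (forall x y z, le x y -> le y z -> le x z).

Definition lt_of {P : Type} (le : P -> P -> Prop) (x y : P) : Prop := le x y /\ x <> y.

Definition countable_set {P : Type} (S : P -> Prop) : Prop :=
  exists g : P -> nat, forall x y, S x -> S y -> g x = g y -> x = y.

Definition locally_countable {P : Type} (le : P -> P -> Prop) : Prop :=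
  forall y, countable_set (fun x => lt_of le x y).

Definition size_continuum {P : Type} (S : P -> Prop) : Prop :=
  exists h : (nat -> bool) -> P,
    (forall r, S (h r)) /\
    (forall r s, h r = h s -> r = s) /\
    (forall x, S x -> exists r, h r = x).

Definition height3 {P : Type} (le : P -> P -> Prop) : Prop :=
  (exists a b c, lt_of le a b /\ lt_of le b c) /\
  ~ (exists a b c d, lt_of le a b /\ lt_of le b c /\ lt_of le c d).

Definition first_level {P : Type} (le : P -> P -> Prop) (x : P) : Prop :=
  forall y, ~ lt_of le y x.

(** f (choosing a representative of each degree) is an embedding into the Turing degrees *)
Definition turing_embedding {P : Type} (le : P -> P -> Prop) (f : P -> nat -> bool) : Prop :=
  forall x y, le x y <-> turing_le (f x) (f y).

(* Main.v *)
(* Let the poset consist of points, of upper bounds of countable sets of points, and of joint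
   upper bounds of such an upper bound with countably many further points. Suppose an
   embedding [f] sends points onto a set containing a perfect set [A], let [b_i] be dense in
   [A], and let [X] be the image of the upper bound of the corresponding points. Then [X]
   computes every [b_i], though not uniformly. Every real [y] is computable from [X] together
   with six elements of [A], so the joint upper bounds lie above too much.

   The six reals follow elements of [b], departing from them infinitely often. A departure can
   be made arbitrarily late, and once the decoder knows a program computing from [X] the
   element being followed, it can find the departure by searching for a disagreement. So
   departures provide arbitrarily large numbers [t] and then [s]. These suffice to find a
   program for the element followed by another real: it is the least program that, within
   [s] steps, agrees with that real below [t]. With three groups of reals departing in turn,
   each program is found from the departures of the other two groups; each group has two
   reals, and the order of their departures codes a bit of [y]. *)
From Stdlib Require Import List Arith Lia Cantor ClassicalEpsilon FunctionalExtensionality.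
Require Import Defs.
Import ListNotations.

(** * Computability relative to an oracle and its closure properties *)

Definition computable (o : nat -> bool) (n : nat) (F : list nat -> nat) : Prop :=
  exists c, forall v, length v = n -> eval o c v (F v).

Definition computable1 o (f : nat -> nat) : Prop :=
  computable o 1 (fun v => f (nth 0 v 0)).
Definition computable2 o (f : nat -> nat -> nat) : Prop :=
  computable o 2 (fun v => f (nth 0 v 0) (nth 1 v 0)).
Definition computable3 o (f : nat -> nat -> nat -> nat) : Prop :=
  computable o 3 (fun v => f (nth 0 v 0) (nth 1 v 0) (nth 2 v 0)).

Section Closure.
Variable o : nat -> bool.

Lemma computable_ext n F G :
  (forall v, length v = n -> F v = G v) -> computable o n F -> computable o n G.
Proof.
  intros H [c Hc]; exists c; intros v Hv; rewrite <- H; auto.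
Qed.

Lemma computable_nth n i : i < n -> computable o n (fun v => nth i v 0).
Proof. intros H; exists (Proj i); intros v Hv; constructor; lia. Qed.

Lemma computable_const n k : computable o n (fun _ => k).
Proof.
  induction k as [|k [c Hc]].
  - exists Zero; intros; constructor.
  - exists (Comp Succ [c]); intros v Hv.
    econstructor; [ econstructor; [ apply Hc, Hv | constructor ] | constructor ].
Qed.

Lemma computable_app1 f n F :
  computable1 o f -> computable o n F -> computable o n (fun v => f (F v)).
Proof.
  intros [c Hc] [d Hd]; exists (Comp c [d]); intros v Hv.
  econstructor.
  - econstructor; [ apply Hd, Hv | constructor ].
  - apply (Hc [F v] eq_refl).
Qed.

Lemma computable_app2 f n F G :
  computable2 o f -> computable o n F -> computable o n G ->
  computable o n (fun v => f (F v) (G v)).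
Proof.
  intros [c Hc] [d Hd] [e He]; exists (Comp c [d; e]); intros v Hv.
  econstructor.
  - econstructor; [ apply Hd, Hv | econstructor; [ apply He, Hv | constructor ] ].
  - apply (Hc [F v; G v] eq_refl).
Qed.

Lemma computable_app3 f n F G H :
  computable3 o f -> computable o n F -> computable o n G -> computable o n H ->
  computable o n (fun v => f (F v) (G v) (H v)).
Proof.
  intros [c Hc] [d Hd] [e He] [k Hk]; exists (Comp c [d; e; k]); intros v Hv.
  econstructor.
  - econstructor; [ apply Hd, Hv | econstructor; [ apply He, Hv | ] ].
    econstructor; [ apply Hk, Hv | constructor ].
  - apply (Hc [F v; G v; H v] eq_refl).
Qed.

(** Projections past a prefix recover the parameters, so a program can discard the counters that
    [Prec] puts in front of them. *)
Lemma evals_proj_suffix u v :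
  evals o (map Proj (seq (length u) (length v))) (u ++ v) v.
Proof.
  revert u; induction v as [|a v IH]; intros u; simpl; constructor.
  - replace a with (nth (length u) (u ++ a :: v) 0) at 2
      by (rewrite app_nth2, Nat.sub_diag; auto).
    constructor; rewrite length_app; simpl; lia.
  - specialize (IH (u ++ [a])).
    rewrite length_app, <- app_assoc, Nat.add_comm in IH; exact IH.
Qed.

Lemma computable_rec n N F (g : list nat -> nat -> nat -> nat) :
  computable o n N -> computable o n F ->
  computable o (S (S n)) (fun w => g (tl (tl w)) (nth 0 w 0) (nth 1 w 0)) ->
  computable o n (fun v => nat_rect (fun _ => nat) (F v) (g v) (N v)).
Proof.
  intros [cN HN] [cF HF] [cG HG].
  exists (Comp (Prec cF cG) (cN :: map Proj (seq 0 n))); intros v Hv.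
  econstructor.
  - constructor; [ apply HN, Hv | subst n; apply (evals_proj_suffix [] v) ].
  - induction (N v) as [|m IH]; simpl; econstructor; eauto.
    apply (HG (m :: _ :: v)); simpl; lia.
Qed.

Lemma computable_nth_tl n i j :
  i + j < n -> computable o n (fun v => nth i (Nat.iter j (@tl nat) v) 0).
Proof.
  intros H; apply computable_ext with (F := fun v => nth (i + j) v 0).
  2: now apply computable_nth.
  intros v _; revert i v H; induction j as [|j IH]; intros i v H; simpl.
  - now rewrite Nat.add_0_r.
  - replace (i + S j) with (S i + j) by lia; rewrite IH by lia.
    destruct (Nat.iter j (@tl nat) v); simpl; auto; now destruct i.
Qed.

Lemma computable_nth_tl1 n i : S i < n -> computable o n (fun v => nth i (tl v) 0).
Proof. intros; apply (computable_nth_tl n i 1); lia. Qed.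
Lemma computable_nth_tl2 n i : S (S i) < n -> computable o n (fun v => nth i (tl (tl v)) 0).
Proof. intros; apply (computable_nth_tl n i 2); lia. Qed.

End Closure.

(* Decidable predicates are coded by natural numbers, with 0 for truth: conjunction is then
   [+], disjunction is [*], and a test can be fed directly to [Mu]. *)
Definition ifz (c a b : nat) : nat := nat_rect (fun _ => nat) a (fun _ _ => b) c.
Definition dist (a b : nat) : nat := (a - b) + (b - a).
Definition sumn (t : nat) (p : nat -> nat) : nat :=
  nat_rect (fun _ => nat) 0 (fun m r => r + p m) t.
Definition prodn (t : nat) (p : nat -> nat) : nat :=
  nat_rect (fun _ => nat) 1 (fun m r => r * p m) t.
(* The least zero of [p] below [n], and [n] if there is none. *)
Definition lmin (p : nat -> nat) (n : nat) : nat :=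
  nat_rect (fun _ => nat) 0 (fun m r => ifz (p r) r (S m)) n.

Lemma dist_eq0 a b : dist a b = 0 <-> a = b.
Proof. unfold dist; lia. Qed.

Lemma sumn_eq0 t p : sumn t p = 0 <-> forall k, k < t -> p k = 0.
Proof.
  induction t as [|t IH].
  - split; [ intros; lia | reflexivity ].
  - change (sumn (S t) p) with (sumn t p + p t); split.
    + intros H k Hk; destruct (Nat.eq_dec k t) as [->|]; [ lia | apply IH; lia ].
    + intros H; rewrite (H t) by lia.
      assert (sumn t p = 0) by (apply IH; intros; apply H; lia); lia.
Qed.

Lemma prodn_eq0 t p : prodn t p = 0 <-> exists k, k < t /\ p k = 0.
Proof.
  induction t as [|t IH].
  - split; [ discriminate | intros (k & Hk & _); lia ].
  - change (prodn (S t) p) with (prodn t p * p t); rewrite Nat.mul_eq_0, IH; split.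
    + intros [(k & Hk & H)|H]; [ exists k | exists t ]; split; auto.
    + intros (k & Hk & H); destruct (Nat.eq_dec k t) as [->|]; auto.
      left; exists k; split; auto; lia.
Qed.

Lemma sumn_ext t p q : (forall k, k < t -> p k = q k) -> sumn t p = sumn t q.
Proof. intros H; induction t; simpl; auto; unfold sumn in *; rewrite IHt, H; auto. Qed.

Lemma prodn_ext t p q : (forall k, k < t -> p k = q k) -> prodn t p = prodn t q.
Proof. intros H; induction t; simpl; auto; unfold prodn in *; rewrite IHt, H; auto. Qed.

Lemma lmin_ext p q n : (forall k, p k = q k) -> lmin p n = lmin q n.
Proof.
  intros H; induction n; simpl; auto; unfold lmin in *; rewrite IHn, H; auto.
Qed.

Lemma lmin_spec p n :
  lmin p n <= n /\ (p (lmin p n) = 0 \/ lmin p n = n) /\ forall m, m < lmin p n -> p m <> 0.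
Proof.
  induction n as [|n (H1 & H2 & H3)].
  - split; [ auto | split; [ auto | intros m Hm; change (lmin p 0) with 0 in Hm; lia ] ].
  - change (lmin p (S n)) with (ifz (p (lmin p n)) (lmin p n) (S n)).
    destruct (p (lmin p n)) as [|q] eqn:E; simpl.
    + split; [ lia | split; auto ].
    + split; [ lia | split; auto ].
      (* As long as no zero has been found, the running value equals the counter. *)
      destruct H2 as [H2|H2]; [ discriminate | ].
      intros m Hm; destruct (Nat.eq_dec m n) as [->|]; [ congruence | apply H3; lia ].
Qed.

Lemma lmin_unique p n e :
  e <= n -> p e = 0 -> (forall m, m < e -> p m <> 0) -> lmin p n = e.
Proof.
  intros He H1 H2; destruct (lmin_spec p n) as (L1 & L2 & L3).
  destruct (lt_eq_lt_dec (lmin p n) e) as [[H|H]|H]; auto.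
  - destruct L2 as [L2|L2]; [ now apply H2 in H | lia ].
  - now apply L3 in H.
Qed.

Section Operations.
Variable o : nat -> bool.

Lemma computable_S n F : computable o n F -> computable o n (fun v => S (F v)).
Proof.
  apply (computable_app1 o S); exists Succ; intros [|a [|]] H; try discriminate; constructor.
Qed.


Ltac comp0 :=
  repeat (cbv beta;
    first
    [ apply computable_const
    | apply computable_nth; simpl; lia
    | apply computable_nth_tl1; simpl; lia
    | apply computable_nth_tl2; simpl; lia
    | apply computable_S ]).

Lemma computable_add : computable2 o Nat.add.
Proof.
  apply computable_ext with
    (F := fun v => nat_rect (fun _ => nat) (nth 1 v 0) (fun _ r => S r) (nth 0 v 0)).
  - intros v _; induction (nth 0 v 0); simpl; auto.
  - apply (computable_rec o 2 _ _ (fun _ _ r => S r)); comp0.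
Qed.

Lemma computable_pred : computable1 o pred.
Proof.
  apply computable_ext with
    (F := fun v => nat_rect (fun _ => nat) 0 (fun m _ => m) (nth 0 v 0)).
  - intros v _; destruct (nth 0 v 0); reflexivity.
  - apply (computable_rec o 1 _ _ (fun _ m _ => m)); comp0.
Qed.

Lemma computable_sub : computable2 o Nat.sub.
Proof.
  apply computable_ext with
    (F := fun v => nat_rect (fun _ => nat) (nth 0 v 0) (fun _ r => pred r) (nth 1 v 0)).
  - intros v _; induction (nth 1 v 0); simpl; lia.
  - apply (computable_rec o 2 _ _ (fun _ _ r => pred r)); comp0.
    apply (computable_app1 o pred); [ apply computable_pred | comp0 ].
Qed.

Lemma computable_mul : computable2 o Nat.mul.
Proof.
  apply computable_ext with
    (F := fun v => nat_rect (fun _ => nat) 0 (fun _ r => nth 1 v 0 + r) (nth 0 v 0)).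
  - intros v _; induction (nth 0 v 0); simpl; lia.
  - apply (computable_rec o 2 _ _ (fun v _ r => nth 1 v 0 + r)); comp0.
    apply (computable_app2 o Nat.add); [ apply computable_add | comp0 | comp0 ].
Qed.

Lemma computable_ifz : computable3 o ifz.
Proof.
  apply (computable_rec o 3 _ _ (fun v _ _ => nth 2 v 0)); comp0.
Qed.

Lemma computable_dist : computable2 o dist.
Proof.
  unfold dist; apply (computable_app2 o Nat.add); [ apply computable_add | | ];
  apply (computable_app2 o Nat.sub); (apply computable_sub || comp0).
Qed.

Lemma computable_sumn n T p :
  computable o n T -> computable o (S n) (fun w => p (tl w) (nth 0 w 0)) ->
  computable o n (fun v => sumn (T v) (p v)).
Proof.
  intros HT [c Hc]; apply (computable_rec o n _ _ (fun v m r => r + p v m)); auto; [comp0|].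
  apply (computable_app2 o Nat.add); [ apply computable_add | comp0 | ].
  exists (Comp c (Proj 0 :: map Proj (seq 2 n))).
  intros [|m [|r v]] Hv; try discriminate; injection Hv as Hv; econstructor.
  - constructor; [ apply (eProj o 0 (m :: r :: v)); simpl; lia | ].
    rewrite <- Hv; apply (evals_proj_suffix o [m; r] v).
  - apply (Hc (m :: v)); simpl; lia.
Qed.

Lemma computable_prodn n T p :
  computable o n T -> computable o (S n) (fun w => p (tl w) (nth 0 w 0)) ->
  computable o n (fun v => prodn (T v) (p v)).
Proof.
  intros HT [c Hc]; apply (computable_rec o n _ _ (fun v m r => r * p v m)); auto; [comp0|].
  apply (computable_app2 o Nat.mul); [ apply computable_mul | comp0 | ].
  exists (Comp c (Proj 0 :: map Proj (seq 2 n))).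
  intros [|m [|r v]] Hv; try discriminate; injection Hv as Hv; econstructor.
  - constructor; [ apply (eProj o 0 (m :: r :: v)); simpl; lia | ].
    rewrite <- Hv; apply (evals_proj_suffix o [m; r] v).
  - apply (Hc (m :: v)); simpl; lia.
Qed.

Lemma computable_lmin n T p :
  computable o n T -> computable o (S n) (fun w => p (tl w) (nth 0 w 0)) ->
  computable o n (fun v => lmin (p v) (T v)).
Proof.
  intros HT [c Hc].
  apply (computable_rec o n _ _ (fun v m r => ifz (p v r) r (S m))); auto; [comp0|].
  apply (computable_app3 o ifz); [ apply computable_ifz | | comp0 | comp0 ].
  (* [lmin] tests its running value, hence [Proj 1] rather than the counter. *)
  exists (Comp c (Proj 1 :: map Proj (seq 2 n))).
  intros [|m [|r v]] Hv; try discriminate; injection Hv as Hv; econstructor.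
  - constructor; [ apply (eProj o 1 (m :: r :: v)); simpl; lia | ].
    rewrite <- Hv; apply (evals_proj_suffix o [m; r] v).
  - apply (Hc (r :: v)); simpl; lia.
Qed.

End Operations.

Create HintDb comp.
#[local] Hint Resolve computable_add computable_pred computable_sub computable_mul
  computable_ifz computable_dist : comp.

Ltac comp :=
  repeat (cbv beta;
    match goal with
    | |- computable _ _ (fun _ => _) => apply computable_const
    | |- computable _ _ (fun v => nth _ v 0) => apply computable_nth; simpl; lia
    | |- computable _ _ (fun v => nth _ (tl v) 0) => apply computable_nth_tl1; simpl; lia
    | |- computable _ _ (fun v => nth _ (tl (tl v)) 0) =>
        apply computable_nth_tl2; simpl; lia
    | |- computable _ _ (fun v => S (@?F v)) => apply (computable_S _ _ F)
    | |- computable _ _ (fun v => sumn (@?T v) (@?p v)) => apply (computable_sumn _ _ T p)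
    | |- computable _ _ (fun v => prodn (@?T v) (@?p v)) => apply (computable_prodn _ _ T p)
    | |- computable _ _ (fun v => lmin (@?p v) (@?T v)) => apply (computable_lmin _ _ T p)
    | |- computable _ _ (fun v => ?f (@?F v)) =>
        apply (computable_app1 _ f _ F); [ solve [ auto with comp ] | ]
    | |- computable _ _ (fun v => ?f (@?F v) (@?G v)) =>
        apply (computable_app2 _ f _ F G); [ solve [ auto with comp ] | | ]
    | |- computable _ _ (fun v => ?f (@?F v) (@?G v) (@?H v)) =>
        apply (computable_app3 _ f _ F G H); [ solve [ auto with comp ] | | | ]
    end).

(** * Pairing, iteration and coding of lists *)

Definition pr (a b : nat) : nat := Cantor.to_nat (a, b).
Definition p1 (n : nat) : nat := fst (Cantor.of_nat n).
Definition p2 (n : nat) : nat := snd (Cantor.of_nat n).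

Lemma p1_pr a b : p1 (pr a b) = a.
Proof. unfold p1, pr; now rewrite Cantor.cancel_of_to. Qed.
Lemma p2_pr a b : p2 (pr a b) = b.
Proof. unfold p2, pr; now rewrite Cantor.cancel_of_to. Qed.
Lemma pr_p n : pr (p1 n) (p2 n) = n.
Proof. unfold p1, p2, pr; now rewrite <- surjective_pairing, Cantor.cancel_to_of. Qed.
Lemma pr_ge a b : a <= pr a b /\ b <= pr a b.
Proof. pose proof (Cantor.to_nat_non_decreasing a b); unfold pr; lia. Qed.

Lemma computable_pr o : computable2 o pr.
Proof.
  (* The Cantor code of [(a, b)] is [b] plus the triangular number of [a + b]. *)
  apply computable_ext with
    (F := fun v => nth 1 v 0 + sumn (S (nth 1 v 0 + nth 0 v 0)) (fun k => k)).
  - intros v _; unfold pr; simpl; f_equal.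
    induction (nth 1 v 0 + nth 0 v 0) as [|m IH]; [ reflexivity | ].
    simpl in *; rewrite <- IH; lia.
  - comp.
Qed.
#[local] Hint Resolve computable_pr : comp.

(** Both components are at most the code, so unpairing is a bounded search. *)
Lemma computable_p1 o : computable1 o p1.
Proof.
  apply computable_ext with
    (F := fun v => lmin (fun a => prodn (S (nth 0 v 0)) (fun b => dist (pr a b) (nth 0 v 0)))
                        (nth 0 v 0)).
  - intros v _; set (n := nth 0 v 0); apply lmin_unique.
    + rewrite <- (pr_p n) at 2; apply pr_ge.
    + apply prodn_eq0; exists (p2 n); rewrite dist_eq0, pr_p; split; auto.
      rewrite <- (pr_p n) at 2; apply Nat.lt_succ_r, pr_ge.
    + intros m Hm H; apply prodn_eq0 in H; destruct H as (b & _ & H).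
      rewrite dist_eq0 in H; rewrite <- H, p1_pr in Hm; lia.
  - comp.
Qed.

Lemma computable_p2 o : computable1 o p2.
Proof.
  apply computable_ext with
    (F := fun v => lmin (fun b => prodn (S (nth 0 v 0)) (fun a => dist (pr a b) (nth 0 v 0)))
                        (nth 0 v 0)).
  - intros v _; set (n := nth 0 v 0); apply lmin_unique.
    + rewrite <- (pr_p n) at 2; apply pr_ge.
    + apply prodn_eq0; exists (p1 n); rewrite dist_eq0, pr_p; split; auto.
      rewrite <- (pr_p n) at 2; apply Nat.lt_succ_r, pr_ge.
    + intros m Hm H; apply prodn_eq0 in H; destruct H as (b & _ & H).
      rewrite dist_eq0 in H; rewrite <- H, p2_pr in Hm; lia.
  - comp.
Qed.
#[local] Hint Resolve computable_p1 computable_p2 : comp.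

Lemma computable_iter o f :
  computable1 o f -> computable2 o (fun n x => Nat.iter n f x).
Proof.
  intros H; apply (computable_rec o 2 _ _ (fun _ _ r => f r)); comp.
Qed.

Lemma computable_table o (fs : list (nat -> nat)) :
  Forall (computable1 o) fs -> computable2 o (fun j d => nth j fs (fun x => x) d).
Proof.
  induction 1 as [|f fs Hf Hfs IH].
  - apply computable_ext with (F := fun v => nth 1 v 0); [ | comp ].
    intros v _; now destruct (nth 0 v 0).
  - apply computable_ext with
      (F := fun v => ifz (nth 0 v 0) (f (nth 1 v 0))
              ((fun j d => nth j fs (fun x => x) d) (pred (nth 0 v 0)) (nth 1 v 0))).
    + intros v _; destruct (nth 0 v 0); reflexivity.
    + apply (computable_app3 o ifz); [ apply computable_ifz | comp | comp | ].
      apply (computable_app2 o (fun j d => nth j fs (fun x => x) d)); [ exact IH | comp | comp ].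
Qed.

(** The successor leaves 0 free for the empty list. *)
Definition cns (a l : nat) : nat := S (pr a l).
Definition hdn (l : nat) : nat := p1 (pred l).
Definition tln (l : nat) : nat := p2 (pred l).
Fixpoint enc (v : list nat) : nat :=
  match v with [] => 0 | a :: v => cns a (enc v) end.

Lemma hdn_cns a l : hdn (cns a l) = a.
Proof. apply p1_pr. Qed.
Lemma tln_cns a l : tln (cns a l) = l.
Proof. apply p2_pr. Qed.

Lemma computable_cns o : computable2 o cns.
Proof. unfold computable2, cns; comp. Qed.
Lemma computable_hdn o : computable1 o hdn.
Proof. unfold computable1, hdn; comp. Qed.
Lemma computable_tln o : computable1 o tln.
Proof. unfold computable1, tln; comp. Qed.
#[local] Hint Resolve computable_cns computable_hdn computable_tln : comp.

(** * A universal WHILE machine with oracle *)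

Section Machine.
Variable X : nat -> bool.

(* The data register holds a stack [pr top rest]; primitives 5 to 14 carry their effect on it. *)
Definition prims : list (nat -> nat) :=
  [ (fun D => pr 0 (p2 D));
    (fun D => pr (S (hdn (p1 D))) (p2 D));
    (fun D => pr (tln (p1 D)) (p2 D));
    (fun D => pr (hdn (p1 D)) (p2 D));
    (fun D => pr (b2n (X (hdn (p1 D)))) (p2 D));
    (* 5: v, r => v, v, r *)
    (fun D => pr (p1 D) D);
    (* 6: y, v, r => v, y, r *)
    (fun D => pr (p1 (p2 D)) (pr (p1 D) (p2 (p2 D))));
    (* 7: w, y, r => y :: w, r *)
    (fun D => pr (cns (p1 (p2 D)) (p1 D)) (p2 (p2 D)));
    (* 8: n :: v, r => v, n, 0, v, r *)
    (fun D => pr (tln (p1 D)) (pr (hdn (p1 D)) (pr 0 (pr (tln (p1 D)) (p2 D)))));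
    (* 9: a, k, m, r => k, m, a, r *)
    (fun D => pr (p1 (p2 D)) (pr (p1 (p2 (p2 D))) (pr (p1 D) (p2 (p2 (p2 D))))));
    (* 10: k, m, a, v, r => m :: a :: v, k - 1, m + 1, v, r *)
    (fun D => pr (cns (p1 (p2 D)) (cns (p1 (p2 (p2 D))) (p1 (p2 (p2 (p2 D))))))
                 (pr (pred (p1 D)) (pr (S (p1 (p2 D))) (p2 (p2 (p2 D))))));
    (* 11: k, n, a, v, r => a, r *)
    (fun D => pr (p1 (p2 (p2 D))) (p2 (p2 (p2 (p2 D)))));
    (* 12: v, r => 0 :: v, 0, v, r *)
    (fun D => pr (cns 0 (p1 D)) (pr 0 D));
    (* 13: y, m, v, r => (m + 1) :: v, m + 1, v, r *)
    (fun D => pr (cns (S (p1 (p2 D))) (p1 (p2 (p2 D)))) (pr (S (p1 (p2 D))) (p2 (p2 D))));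
    (* 14: y, m, v, r => m, r *)
    (fun D => pr (p1 (p2 D)) (p2 (p2 (p2 D))))
  ].

Definition Seq (p q : nat) : nat := pr 0 (pr p q).
Definition While (p : nat) : nat := pr 1 p.
Definition Prim (j : nat) : nat := pr (S (S j)) 0.

(** A state [pr K D] holds a stack [K] of pending programs and the data register [D]. [While] loops
    until the top of [D] is 0. A state with empty [K] has halted and is a fixed point. *)
Definition step (st : nat) : nat :=
  ifz (p1 st) st
    (ifz (p1 (hdn (p1 st)))
       (pr (cns (p1 (p2 (hdn (p1 st)))) (cns (p2 (p2 (hdn (p1 st)))) (tln (p1 st)))) (p2 st))
       (ifz (pred (p1 (hdn (p1 st))))
          (ifz (p1 (p2 st))
             (pr (tln (p1 st)) (p2 st))
             (pr (cns (p2 (hdn (p1 st))) (p1 st)) (p2 st)))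
          (pr (tln (p1 st))
              (nth (pred (pred (p1 (hdn (p1 st))))) prims (fun x => x) (p2 st))))).

(** Quantifying over the continuation [K] lets executions be chained. *)
Definition exec (p D D' : nat) : Prop :=
  forall K, exists n, Nat.iter n step (pr (cns p K) D) = pr K D'.

Lemma iter_add n m x : Nat.iter (n + m) step x = Nat.iter n step (Nat.iter m step x).
Proof. induction n; simpl; congruence. Qed.

Ltac mach := repeat (simpl; rewrite ?p1_pr, ?p2_pr, ?hdn_cns, ?tln_cns).

Lemma step_seq p q K D : step (pr (cns (Seq p q) K) D) = pr (cns p (cns q K)) D.
Proof. unfold step, Seq; mach; reflexivity. Qed.
Lemma step_while0 p K D :
  p1 D = 0 -> step (pr (cns (While p) K) D) = pr K D.
Proof. intros H; unfold step, While; mach; rewrite H; reflexivity. Qed.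
Lemma step_whileS p K D :
  p1 D <> 0 -> step (pr (cns (While p) K) D) = pr (cns p (cns (While p) K)) D.
Proof.
  intros H; unfold step, While; mach; destruct (p1 D); [ congruence | reflexivity ].
Qed.
Lemma step_prim j K D :
  step (pr (cns (Prim j) K) D) = pr K (nth j prims (fun x => x) D).
Proof. unfold step, Prim; rewrite !p1_pr, !p2_pr, hdn_cns, tln_cns, p1_pr; reflexivity. Qed.

Lemma exec_seq p q D1 D2 D3 : exec p D1 D2 -> exec q D2 D3 -> exec (Seq p q) D1 D3.
Proof.
  intros Hp Hq K; destruct (Hp (cns q K)) as [n Hn], (Hq K) as [m Hm].
  exists (m + (n + 1)); now rewrite !iter_add; simpl; rewrite step_seq, Hn, Hm.
Qed.

Lemma exec_while0 p D : p1 D = 0 -> exec (While p) D D.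
Proof. intros H K; exists 1; now apply step_while0. Qed.

Lemma exec_whileS p D1 D2 D3 :
  p1 D1 <> 0 -> exec p D1 D2 -> exec (While p) D2 D3 -> exec (While p) D1 D3.
Proof.
  intros H Hp Hq K; destruct (Hp (cns (While p) K)) as [n Hn], (Hq K) as [m Hm].
  exists (m + (n + 1)); rewrite !iter_add; simpl; now rewrite step_whileS, Hn, Hm.
Qed.

Lemma exec_prim j D D' : nth j prims (fun x => x) D = D' -> exec (Prim j) D D'.
Proof. intros <- K; exists 1; apply step_prim. Qed.

(** The arbitrary [r] says that the stack below the argument is preserved. *)
Definition computes (c : code) (p : nat) : Prop :=
  forall v y, eval X c v y -> forall r, exec p (pr (enc v) r) (pr y r).
Definition computes_list (cs : list code) (p : nat) : Prop :=
  forall v ys, evals X cs v ys -> forall r, exec p (pr (enc v) r) (pr (enc ys) r).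

Ltac prim := apply exec_prim; mach; reflexivity.

Lemma compile_proj i : exists p, computes (Proj i) p.
Proof.
  assert (H : exists p, forall v r, i < length v ->
                exec p (pr (enc v) r) (pr (nth i v 0) r)).
  { induction i as [|i [p Hp]].
    - exists (Prim 3); intros [|a v] r H; simpl in H; [ lia | prim ].
    - exists (Seq (Prim 2) p); intros [|a v] r H; simpl in H; [ lia | ].
      apply exec_seq with (D2 := pr (enc v) r); [ prim | apply Hp; lia ]. }
  destruct H as [p Hp]; exists p; intros v y Hy; inversion Hy; subst; auto.
Qed.

Lemma compile_list cs :
  Forall (fun c => exists p, computes c p) cs -> exists p, computes_list cs p.
Proof.
  induction 1 as [|c cs [p Hp] _ [q Hq]].
  - exists (Prim 0); intros v ys H r; inversion H; subst; prim.
  - exists (Seq (Prim 5) (Seq p (Seq (Prim 6) (Seq q (Prim 7))))).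
    intros v ys H r; inversion H as [|? ? ? y ys' Hy Hys]; subst.
    apply exec_seq with (pr (enc v) (pr (enc v) r)); [ prim | ].
    eapply exec_seq; [ apply Hp, Hy | ].
    apply exec_seq with (pr (enc v) (pr y r)); [ prim | ].
    eapply exec_seq; [ apply Hq, Hys | prim ].
Qed.

Lemma compile_prec f g :
  (exists p, computes f p) -> (exists p, computes g p) -> exists p, computes (Prec f g) p.
Proof.
  intros [p Hp] [q Hq].
  set (W := While (Seq (Prim 10) (Seq q (Prim 9)))).
  exists (Seq (Prim 8) (Seq p (Seq (Prim 9) (Seq W (Prim 11))))).
  (* At the loop head [k] rounds remain, [m] are done, and [a] is the value of the recursion at
     [m]. *)
  set (L := fun k m a v r => pr k (pr m (pr a (pr (enc v) r)))).
  (* A derivation is peeled from its last round, so the loop is built backwards: each induction step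
     prepends a round. *)
  assert (H : forall n v y r, eval X (Prec f g) (n :: v) y -> forall k D,
            exec W (L k n y v r) D ->
            exists y0, eval X f v y0 /\ exec W (L (n + k) 0 y0 v r) D).
  { induction n as [|n IH]; intros v y r Hy k D HD; inversion Hy; subst; eauto.
    match goal with Hr : eval X (Prec f g) (n :: v) ?a |- _ =>
      destruct (IH v a r Hr (S k) D) as (y0 & Hy0 & HE) end.
    - eapply exec_whileS; [ unfold L; rewrite p1_pr; discriminate | | exact HD ].
      eapply exec_seq; [ unfold L; prim | ].
      eapply exec_seq; [ | unfold L; prim ].
      match goal with Hg : eval X g (n :: ?a :: v) y |- _ =>
        apply (Hq (n :: a :: v) y Hg) end.
    - exists y0; split; auto; now rewrite <- plus_n_Sm in HE. }
  intros v y Hy r.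
  assert (exists n v', v = n :: v') as (n & v' & ->) by (inversion Hy; eauto).
  destruct (H n v' y r Hy 0 (L 0 n y v' r)) as (y0 & Hy0 & HE).
  { apply exec_while0; unfold L; now rewrite p1_pr. }
  rewrite Nat.add_0_r in HE.
  apply exec_seq with (pr (enc v') (pr n (pr 0 (pr (enc v') r)))); [ prim | ].
  eapply exec_seq; [ apply Hp, Hy0 | ].
  apply exec_seq with (L n 0 y0 v' r); [ unfold L; prim | ].
  eapply exec_seq; [ exact HE | unfold L; prim ].
Qed.

Lemma compile_mu f : (exists p, computes f p) -> exists p, computes (Mu f) p.
Proof.
  intros [p Hp]; set (W := While (Seq (Prim 13) p)).
  exists (Seq (Prim 12) (Seq p (Seq W (Prim 14)))).
  intros v n Hn r; inversion Hn as [| | | | | | |? ? ? H0 HS]; subst.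
  (* Induction on the distance to the zero [n], where the loop stops; before it the values are
     positive and the loop continues. *)
  assert (H : forall d, d <= n -> exists y, eval X f (n - d :: v) y /\
     exec W (pr y (pr (n - d) (pr (enc v) r))) (pr 0 (pr n (pr (enc v) r)))).
  { induction d as [|d IH]; intros Hd.
    - exists 0; rewrite Nat.sub_0_r; split; auto; apply exec_while0, p1_pr.
    - destruct IH as (y & Hy & HE); [ lia | ].
      destruct (HS (n - S d)) as [k Hk]; [ lia | ].
      exists (S k); split; auto.
      eapply exec_whileS; [ rewrite p1_pr; discriminate | | exact HE ].
      eapply exec_seq; [ prim | ].
      replace (S (n - S d)) with (n - d) by lia.
      apply (Hp (n - d :: v) y Hy). }
  destruct (H n (le_n n)) as (y & Hy & HE); rewrite Nat.sub_diag in *.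
  eapply exec_seq; [ prim | ].
  eapply exec_seq; [ apply (Hp (0 :: v) y Hy) | ].
  eapply exec_seq; [ exact HE | prim ].
Qed.

Lemma compile c : exists p, computes c p.
Proof.
  (* [code] nests lists, so the arguments of [Comp] call for an inner induction inside a raw
     fixpoint. *)
  revert c; fix IH 1; intros [| |i| |f gs|f g|f].
  - exists (Prim 0); intros v y H r; inversion H; subst; prim.
  - exists (Prim 1); intros v y H r; inversion H; subst; prim.
  - apply compile_proj.
  - exists (Prim 4); intros v y H r; inversion H; subst; prim.
  - destruct (IH f) as [p Hp].
    destruct (compile_list gs) as [q Hq].
    { induction gs as [|g gs IHgs]; constructor; [ apply IH | exact IHgs ]. }
    exists (Seq q p); intros v y H r; inversion H; subst.
    eapply exec_seq; [ eapply Hq; eassumption | eapply Hp; eassumption ].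
  - apply compile_prec; apply IH.
  - apply compile_mu; apply IH.
Qed.

(* [S y] if program [e] with input [k] halts within [s] steps with output [y], and 0 if it
   is still running. *)
Definition halts (e k s : nat) : nat :=
  let st := Nat.iter s step (pr (cns e 0) (pr (cns k 0) 0)) in
  ifz (p1 st) (S (p1 (p2 st))) 0.

Lemma halts_mono e k s s' y : halts e k s = S y -> s <= s' -> halts e k s' = S y.
Proof.
  intros H Hs; replace s' with ((s' - s) + s) by lia.
  unfold halts in *; rewrite iter_add.
  set (st := Nat.iter s step _) in *.
  destruct (p1 st) eqn:E; [ | discriminate ].
  replace (Nat.iter (s' - s) step st) with st; [ now rewrite E | ].
  induction (s' - s) as [|d IH]; simpl; auto.
  rewrite <- IH; unfold step; now rewrite E.
Qed.

Lemma halts_complete x :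
  turing_le x X -> exists e, forall k, exists s, halts e k s = S (b2n (x k)).
Proof.
  intros [c Hc]; destruct (compile c) as [e He]; exists e; intros k.
  destruct (He _ _ (Hc k) 0 0) as [s Hs]; exists s.
  unfold halts; simpl in Hs; rewrite Hs; mach; reflexivity.
Qed.

Lemma computable_turing_le o x : turing_le x o -> computable1 o (fun k => b2n (x k)).
Proof.
  intros [c Hc]; exists c; intros [|k [|]] H; try discriminate; apply Hc.
Qed.

(** The machine consults [X] only through primitive 4, so any oracle computing [X] can simulate
    it. *)
Lemma computable_halts o : turing_le X o -> computable3 o halts.
Proof.
  intros HX; apply computable_turing_le in HX.
  assert (Hprims : computable2 o (fun j d => nth j prims (fun x => x) d)).
  { apply computable_table; unfold prims.
    repeat constructor; unfold computable1; try solve [ comp ].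
    apply (computable_app2 o pr); [ auto with comp | | comp ].
    apply (computable_app1 o (fun k => b2n (X k))); [ exact HX | comp ]. }
  assert (Hstep : computable1 o step).
  { unfold computable1, step; comp.
    apply (computable_app2 o (fun j d => nth j prims (fun x => x) d)); [ exact Hprims | comp | comp ]. }
  pose proof (computable_iter o step Hstep) as Hiter.
  assert (Hst : computable3 o
            (fun e k s => Nat.iter s step (pr (cns e 0) (pr (cns k 0) 0)))).
  { apply (computable_app2 o (fun n x => Nat.iter n step x)); [ exact Hiter | comp | comp ]. }
  unfold computable3, halts; cbv zeta.
  set (st := fun e k s => Nat.iter s step (pr (cns e 0) (pr (cns k 0) 0))) in *.
  change (computable o 3 (fun v => ifz (p1 (st (nth 0 v 0) (nth 1 v 0) (nth 2 v 0)))
     (S (p1 (p2 (st (nth 0 v 0) (nth 1 v 0) (nth 2 v 0))))) 0)).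
  clearbody st; comp.
Qed.

End Machine.

(** * Choice, finite bounds and residues modulo 3 *)

Lemma dependent_choice (T : Type) (P : nat -> T -> Prop) (R : nat -> T -> T -> Prop) x0 :
  P 0 x0 -> (forall i x, P i x -> exists y, P (S i) y /\ R i x y) ->
  exists f, forall i, P i (f i) /\ R i (f i) (f (S i)).
Proof.
  intros H0 HS.
  assert (next : forall i x, {y | P i x -> P (S i) y /\ R i x y}).
  { intros i x; apply constructive_indefinite_description.
    destruct (classic (P i x)) as [H|H]; [ | exists x; tauto ].
    destruct (HS i x H) as [y Hy]; exists y; auto. }
  set (f := nat_rect (fun _ => T) x0 (fun i x => proj1_sig (next i x))).
  assert (HP : forall i, P i (f i)).
  { induction i as [|i IH]; auto; apply (proj2_sig (next i (f i))), IH. }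
  exists f; intros i; split; auto; apply (proj2_sig (next i (f i))), HP.
Qed.

Lemma least_nat (Q : nat -> Prop) :
  (exists n, Q n) -> exists n, Q n /\ forall m, m < n -> ~ Q m.
Proof.
  intros [n Hn]; revert Hn; induction n as [n IH] using lt_wf_ind; intros Hn.
  destruct (classic (exists m, m < n /\ Q m)) as [(m & Hm & HQ)|H]; eauto.
  exists n; split; auto; intros m Hm HQ; apply H; eauto.
Qed.

Lemma eventually_all_below (Q : nat -> nat -> Prop) n :
  (forall k, k < n -> exists s0, forall s, s0 <= s -> Q k s) ->
  exists s0, forall s, s0 <= s -> forall k, k < n -> Q k s.
Proof.
  induction n as [|n IH]; intros H; [ exists 0; intros; lia | ].
  destruct IH as [s1 H1]; [ intros; apply H; lia | ].
  destruct (H n) as [s2 H2]; [ lia | ].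
  exists (s1 + s2); intros s Hs k Hk; destruct (Nat.eq_dec k n) as [->|];
    [ apply H2; lia | apply H1; lia ].
Qed.

(* The residue of [i] modulo 3. *)
Definition cyc (i : nat) : nat :=
  nat_rect (fun _ => nat) 0 (fun _ r => ifz (2 - r) 0 (S r)) i.

Lemma cyc_S i : cyc (S i) = ifz (2 - cyc i) 0 (S (cyc i)).
Proof. reflexivity. Qed.

Lemma cyc_lt i : cyc i < 3.
Proof.
  induction i as [|i IH]; [ simpl; lia | rewrite cyc_S ].
  destruct (cyc i) as [|[|[|]]]; simpl; lia.
Qed.

Lemma cyc_neq1 i : cyc (S i) <> cyc i.
Proof.
  rewrite cyc_S; pose proof (cyc_lt i); destruct (cyc i) as [|[|[|]]]; simpl; lia.
Qed.

Lemma cyc_neq2 i : cyc (S (S i)) <> cyc i.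
Proof.
  rewrite !cyc_S; pose proof (cyc_lt i); destruct (cyc i) as [|[|[|]]]; simpl; lia.
Qed.

Lemma computable_cyc o : computable1 o cyc.
Proof.
  apply (computable_rec o 1 _ _ (fun _ _ r => ifz (2 - r) 0 (S r))); comp.
Qed.
#[local] Hint Resolve computable_cyc : comp.

(** * Coding into a perfect set *)

Section Decoding.
(* [h] abstracts [halts X]. *)
Variable h : nat -> nat -> nat -> nat.

Definition disagreement (e t s : nat) (z : nat -> nat) : nat :=
  sumn t (fun k => dist (h e k s) (S (z k))).

(** Here [s] bounds both the running times and the search over programs. *)
Definition guess (z : nat -> nat) (t s : nat) : nat :=
  lmin (fun e => disagreement e t s z) s.

(* Vanishes iff, within [u] steps, program [e] is seen to agree with [z] up to some [k < u]
   and to differ from it at [k]. *)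
Definition departed (e : nat) (z : nat -> nat) (u : nat) : nat :=
  prodn u (fun k => dist (h e k u) (2 - z k) + disagreement e k u z).

(** Minimality makes [u] the value returned by an unbounded search. *)
Definition departs_at (z : nat -> nat) (t s u : nat) : Prop :=
  departed (guess z t s) z u = 0 /\
  forall u', u' < u -> departed (guess z t s) z u' <> 0.

Lemma disagreement_eq0 e t s z :
  disagreement e t s z = 0 <-> forall k, k < t -> h e k s = S (z k).
Proof.
  unfold disagreement; rewrite sumn_eq0.
  split; intros H k Hk; apply dist_eq0; apply H, Hk.
Qed.

(** For a bit [z k], [2 - z k] is the value by which [halts] reports the opposite bit. *)
Lemma departed_eq0 e z u :
  departed e z u = 0 <->
  exists k, k < u /\ h e k u = 2 - z k /\ forall k', k' < k -> h e k' u = S (z k').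
Proof.
  unfold departed; rewrite prodn_eq0; split; intros (k & Hk & H); exists k; split; auto.
  - apply Nat.eq_add_0 in H; now rewrite dist_eq0, disagreement_eq0 in H.
  - apply Nat.eq_add_0; now rewrite dist_eq0, disagreement_eq0.
Qed.

Lemma disagreement_ext e t s z z' :
  (forall k, k < t -> z k = z' k) -> disagreement e t s z = disagreement e t s z'.
Proof. intros H; apply sumn_ext; intros k Hk; now rewrite H. Qed.

Lemma guess_ext z z' t s :
  (forall k, k < t -> z k = z' k) -> guess z t s = guess z' t s.
Proof. intros H; apply lmin_ext; intros e; now apply disagreement_ext. Qed.

Lemma departed_ext e z z' u :
  (forall k, k < u -> z k = z' k) -> departed e z u = departed e z' u.
Proof.
  intros H; apply prodn_ext; intros k Hk.
  rewrite H by auto; f_equal; apply disagreement_ext; intros; apply H; lia.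
Qed.

(** A departure reads only finitely many bits, so it survives later changes of the real. *)
Lemma departs_at_ext z z' t s u M :
  (forall k, k < M -> z k = z' k) -> t <= M -> u <= M ->
  departs_at z t s u -> departs_at z' t s u.
Proof.
  intros H Ht Hu [H1 H2]; unfold departs_at.
  rewrite <- (guess_ext z z') by (intros; apply H; lia).
  rewrite <- (departed_ext _ z z') by (intros; apply H; lia); split; auto.
  intros u' Hu'; rewrite <- (departed_ext _ z z') by (intros; apply H; lia); auto.
Qed.

Hypothesis h_mono : forall e k s s' y, h e k s = S y -> s <= s' -> h e k s' = S y.

Definition index_of (x : nat -> bool) (e : nat) : Prop :=
  forall k, exists s, h e k s = S (b2n (x k)).
Definition nat_of (x : nat -> bool) : nat -> nat := fun k => b2n (x k).

(* [t] exceeds the length on which any program preceding the least index of [x] agrees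
   with [x]. *)
Definition separates (t : nat) (x : nat -> bool) : Prop :=
  exists e, index_of x e /\
    forall e', e' < e -> exists k, k < t /\ forall s, h e' k s <> S (b2n (x k)).

(** Each of the finitely many programs below the least index of [x] fails at some position. *)
Lemma separates_eventually x :
  (exists e, index_of x e) -> exists t0, forall t, t0 <= t -> separates t x.
Proof.
  intros Hx; destruct (least_nat _ Hx) as (e & He & Hmin).
  destruct (eventually_all_below
    (fun e' t => exists k, k < t /\ forall s, h e' k s <> S (b2n (x k))) e) as [t0 H].
  - intros e' He'; apply Hmin in He'.
    apply not_all_ex_not in He'; destruct He' as [k Hk].
    exists (S k); intros t Ht; exists k; split; auto.
    intros s Hs; apply Hk; eauto.
  - exists t0; intros t Ht; exists e; split; auto; now apply H.
Qed.

Lemma converges_eventually x e n :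
  index_of x e ->
  exists s0, forall s, s0 <= s -> forall k, k < n -> h e k s = S (b2n (x k)).
Proof.
  intros He; apply eventually_all_below; intros k _.
  destruct (He k) as [s0 Hs]; exists s0; intros s; now apply h_mono.
Qed.

(** Smaller programs are refuted below [t] whatever the number of steps, while the least index is
    confirmed there after enough steps. *)
Lemma guess_correct_eventually t x :
  separates t x ->
  exists s0, forall s, s0 <= s -> index_of x (guess (nat_of x) t s).
Proof.
  intros (e & He & Hlt); destruct (converges_eventually x e t He) as [s0 Hs0].
  exists (e + s0); intros s Hs; unfold guess.
  rewrite (lmin_unique _ s e); auto; try lia.
  - apply disagreement_eq0; apply Hs0; lia.
  - intros e' He' H; destruct (Hlt e' He') as (k & Hk & Hne).
    apply (Hne s); now rewrite disagreement_eq0 in H; apply H.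
Qed.

Lemma departure_exists x x' e n :
  index_of x e -> agree_upto n x x' -> x n <> x' n ->
  exists u, n < u /\ departed e (nat_of x') u = 0 /\
            forall u', u' < u -> departed e (nat_of x') u' <> 0.
Proof.
  intros He Hag Hn.
  destruct (least_nat (fun u => departed e (nat_of x') u = 0)) as (u & Hu & Hmin).
  - destruct (converges_eventually x e (S n) He) as [s Hs].
    exists (S n + s); apply departed_eq0; exists n; repeat split; [ lia | | ].
    + rewrite Hs by lia; unfold nat_of.
      destruct (x n), (x' n); simpl; congruence.
    + intros k Hk; rewrite Hs by lia; unfold nat_of; now rewrite Hag.
  - exists u; repeat split; auto.
    apply departed_eq0 in Hu; destruct Hu as (k & Hk & Hku & _).
    (* Below [n] the program outputs the common bits of [x] and [x'], so no departure is seen there;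
       this forces [u] beyond [n]. *)
    destruct (Nat.le_gt_cases n k) as [|Hlt]; [ lia | exfalso ].
    destruct (He k) as [s Hs].
    assert (Hx : h e k (u + s) = S (b2n (x k))) by (apply h_mono with s; auto; lia).
    assert (Hx' : h e k (u + s) = 2 - nat_of x' k).
    (* Fixing the bit turns [2 - nat_of x' k] into a successor, as [h_mono] requires. *)
    { unfold nat_of in *; destruct (x' k); simpl in *; eapply h_mono; eauto; lia. }
    rewrite Hag in Hx by auto; unfold nat_of in Hx'.
    destruct (x' k); simpl in *; congruence.
Qed.

Variable b : nat -> nat -> bool.
Hypothesis b_index : forall i, exists e, index_of (b i) e.
Hypothesis b_branching :
  forall i n, exists j m, n <= m /\ agree_upto m (b i) (b j) /\ b i m <> b j m.

Lemma departure_from i t s M :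
  index_of (b i) (guess (nat_of (b i)) t s) -> t <= M ->
  exists j u, M < u /\ agree_upto M (b i) (b j) /\ departs_at (nat_of (b j)) t s u.
Proof.
  intros He Ht; destruct (b_branching i M) as (j & m & Hm & Hag & Hne).
  destruct (departure_exists _ _ _ _ He Hag Hne) as (u & Hu & H1 & H2).
  assert (Hag' : agree_upto M (b i) (b j)) by (intros k Hk; apply Hag; lia).
  exists j, u; split; [ lia | split; auto ].
  unfold departs_at; rewrite <- (guess_ext (nat_of (b i))); auto.
  intros k Hk; unfold nat_of; f_equal; apply Hag'; lia.
Qed.

(* The six reals form three groups [r] and [r + 3], [r < 3], where [r] is the residue of the
   stage at which the group departs. A real currently follows [b (cur r)] and its first
   [len] bits are fixed; [adv1] and [adv2] are the bounds from which the decoder guesses the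
   programs of the group about to depart. *)
Record stage := Stage { cur : nat -> nat; adv1 : nat; adv2 : nat; len : nat }.

(** The group departing now must already be guessed correctly. For the next group only the first
    bound, [adv2], is fixed; its second bound is the departure time about to be chosen. *)
Definition invariant (i : nat) (st : stage) : Prop :=
  adv1 st <= len st /\ adv2 st <= len st /\
  forall d, d = 0 \/ d = 3 ->
    index_of (b (cur st (cyc i + d)))
             (guess (nat_of (b (cur st (cyc i + d)))) (adv1 st) (adv2 st)) /\
    separates (adv2 st) (b (cur st (cyc (S i) + d))).

Definition transition (y : nat -> bool) (i : nat) (st st' : stage) : Prop :=
  len st < len st' /\
  (forall r, agree_upto (len st) (b (cur st r)) (b (cur st' r))) /\
  adv1 st' = adv2 st /\
  departs_at (nat_of (b (cur st' (cyc i)))) (adv1 st) (adv2 st) (adv2 st') /\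
  exists u, u <= len st' /\
    departs_at (nat_of (b (cur st' (cyc i + 3)))) (adv1 st) (adv2 st) u /\
    (adv2 st' < u <-> y i = true).

Lemma transition_exists y i st :
  invariant i st -> exists st', invariant (S i) st' /\ transition y i st st'.
Proof.
  intros (Ht & Hs & Hinv).
  (* Every departure time from [M] on serves as second bound for the next group and as first bound
     for the one after it. *)
  assert (Hb : exists M, len st <= M /\ forall u, M <= u -> forall d, d = 0 \/ d = 3 ->
     index_of (b (cur st (cyc (S i) + d)))
              (guess (nat_of (b (cur st (cyc (S i) + d)))) (adv2 st) u) /\
     separates u (b (cur st (cyc (S (S i)) + d)))).
  { destruct (Hinv 0) as [_ S0]; auto; destruct (Hinv 3) as [_ S3]; auto.
    apply guess_correct_eventually in S0, S3.
    destruct S0 as [a0 A0], S3 as [a3 A3].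
    destruct (separates_eventually _ (b_index (cur st (cyc (S (S i)) + 0)))) as [c0 C0].
    destruct (separates_eventually _ (b_index (cur st (cyc (S (S i)) + 3)))) as [c3 C3].
    exists (len st + a0 + a3 + c0 + c3); split; [ lia | ].
    intros u Hu d [-> | ->]; split; [ apply A0 | apply C0 | apply A3 | apply C3 ]; lia. }
  destruct Hb as (M & HM & HMu).
  destruct (Hinv 0) as [I0 _]; auto; destruct (Hinv 3) as [I3 _]; auto.
  rewrite Nat.add_0_r in I0.
  assert (Hdep : exists j0 u0 j3 u3, M < u0 /\ M < u3 /\
     agree_upto M (b (cur st (cyc i))) (b j0) /\
     agree_upto M (b (cur st (cyc i + 3))) (b j3) /\
     departs_at (nat_of (b j0)) (adv1 st) (adv2 st) u0 /\
     departs_at (nat_of (b j3)) (adv1 st) (adv2 st) u3 /\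
     (u0 < u3 <-> y i = true)).
  (* The real that must depart second stays unchanged past the departure time of the other. *)
  { destruct (y i).
    - destruct (departure_from _ _ _ M I0) as (j0 & u0 & U0 & G0 & D0); [ lia | ].
      destruct (departure_from _ _ _ u0 I3) as (j3 & u3 & U3 & G3 & D3); [ lia | ].
      exists j0, u0, j3, u3; repeat (split; auto); try lia; try apply D0; try apply D3.
      intros k Hk; apply G3; lia.
    - destruct (departure_from _ _ _ M I3) as (j3 & u3 & U3 & G3 & D3); [ lia | ].
      destruct (departure_from _ _ _ u3 I0) as (j0 & u0 & U0 & G0 & D0); [ lia | ].
      exists j0, u0, j3, u3; repeat (split; auto); try lia; try discriminate;
        try apply D0; try apply D3.
      intros k Hk; apply G0; lia. }
  destruct Hdep as (j0 & u0 & j3 & u3 & U0 & U3 & G0 & G3 & D0 & D3 & Hy).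
  set (cur' := fun r => if r =? cyc i then j0 else if r =? cyc i + 3 then j3 else cur st r).
  assert (C0 : cur' (cyc i) = j0) by (unfold cur'; now rewrite Nat.eqb_refl).
  assert (C3 : cur' (cyc i + 3) = j3).
  { unfold cur'; rewrite Nat.eqb_refl.
    destruct (Nat.eqb_spec (cyc i + 3) (cyc i)); auto; lia. }
  (* The other two groups do not move, so what [Hb] says about them remains true. *)
  assert (C : forall r d, r < 3 -> r <> cyc i -> d = 0 \/ d = 3 ->
                          cur' (r + d) = cur st (r + d)).
  { intros r d Hr Hne Hd; pose proof (cyc_lt i); unfold cur'.
    destruct (Nat.eqb_spec (r + d) (cyc i)), (Nat.eqb_spec (r + d) (cyc i + 3)); auto; lia. }
  exists (Stage cur' (adv2 st) u0 (len st + u0 + u3)); split; unfold invariant, transition;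
    cbn [adv1 adv2 len cur].
  - split; [ lia | split; [ lia | ] ]; intros d Hd.
    rewrite !C; auto using cyc_lt, cyc_neq1, cyc_neq2.
    apply HMu; auto; lia.
  - split; [ lia | ]; split.
    { intros r k Hk; unfold cur'; destruct (Nat.eqb_spec r (cyc i)) as [->|].
      - apply G0; lia.
      - destruct (Nat.eqb_spec r (cyc i + 3)) as [->|]; auto; apply G3; lia. }
    rewrite C0, C3; split; auto; split; auto; exists u3; split; [ lia | auto ].
Qed.

Lemma coding (A : (nat -> bool) -> Prop) (y : nat -> bool) :
  closed_set A -> (forall i, A (b i)) ->
  exists (z : nat -> nat -> bool) (t0 : nat) (s u : nat -> nat),
    (forall r, A (z r)) /\
    forall i, let t := match i with 0 => t0 | S j => s j end in
      departs_at (nat_of (z (cyc i))) t (s i) (s (S i)) /\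
      departs_at (nat_of (z (cyc i + 3))) t (s i) (u i) /\
      (s (S i) < u i <-> y i = true).
Proof.
  intros HA HbA.
  destruct (separates_eventually _ (b_index 0)) as [t0 Ht0].
  destruct (guess_correct_eventually t0 (b 0)) as [s0 Hs0]; [ auto | ].
  (* All reals start at [b 0]; [t0 + s0] is late enough for both clauses of the invariant. *)
  destruct (dependent_choice stage invariant (transition y)
              (Stage (fun _ => 0) t0 (t0 + s0) (t0 + s0))) as [st Hst].
  { split; [ simpl; lia | split; [ simpl; lia | ] ]; simpl.
    intros d _; split; [ apply Hs0; lia | apply Ht0; lia ]. }
  { apply transition_exists. }
  assert (Hlen : forall i, i <= len (st i)).
  { induction i as [|i IH]; [ lia | ].
    destruct (Hst i) as (_ & Hl & _); lia. }
  assert (Hcur : forall r i d, agree_upto (len (st i)) (b (cur (st i) r)) (b (cur (st (d + i)) r))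
                  /\ len (st i) <= len (st (d + i))).
  { intros r i; induction d as [|d [IH1 IH2]]; [ split; [ intros k _ |]; auto | ].
    destruct (Hst (d + i)) as (_ & Hl & Hag & _); split; [ | simpl; lia ].
    intros k Hk; rewrite (IH1 k Hk); apply Hag; lia. }
  (* Bit [k] is fixed by stage [S k], whose [len] exceeds [k]. *)
  set (z := fun r k => b (cur (st (S k)) r) k).
  assert (Hz : forall r i, agree_upto (len (st i)) (b (cur (st i) r)) (z r)).
  { intros r i k Hk; unfold z.
    destruct (Nat.le_gt_cases i (S k)) as [H|H].
    - replace (S k) with ((S k - i) + i) by lia; now apply Hcur.
    - replace i with ((i - S k) + S k) by lia; symmetry; apply Hcur.
      pose proof (Hlen (S k)); lia. }
  assert (Hu : forall i, exists u, u <= len (st (S i)) /\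
    departs_at (nat_of (b (cur (st (S i)) (cyc i + 3)))) (adv1 (st i)) (adv2 (st i)) u /\
    (adv2 (st (S i)) < u <-> y i = true)).
  { intros i; apply (Hst i). }
  assert (exists u, forall i, u i <= len (st (S i)) /\
    departs_at (nat_of (b (cur (st (S i)) (cyc i + 3)))) (adv1 (st i)) (adv2 (st i)) (u i) /\
    (adv2 (st (S i)) < u i <-> y i = true)) as [u Hu'].
  { exists (fun i => proj1_sig (constructive_indefinite_description _ (Hu i))).
    intros i; apply (proj2_sig (constructive_indefinite_description _ (Hu i))). }
  exists z, (adv1 (st 0)), (fun i => adv2 (st i)), u; split.
  - intros r; apply HA; intros n; exists (b (cur (st n) r)); split; auto.
    intros k Hk; symmetry; apply Hz; pose proof (Hlen n); lia.
  - intros i t.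
    assert (t = adv1 (st i)) as ->.
    { destruct i; auto; symmetry; apply (Hst i). }
    destruct (Hst i) as ((H1 & H2 & _) & Hl & _ & _ & Hd & _).
    destruct (Hu' i) as (Hui & Hd' & Hy).
    destruct (Hst (S i)) as ((_ & H3 & _) & _).
    assert (E : forall r k, k < len (st (S i)) ->
                  nat_of (b (cur (st (S i)) r)) k = nat_of (z r) k).
    { intros r k Hk; unfold nat_of; f_equal; now apply Hz. }
    split; [ | split; auto ].
    + apply departs_at_ext with (2 := Nat.le_trans _ _ _ H1 (Nat.lt_le_incl _ _ Hl)) (4 := Hd); auto.
    + apply departs_at_ext with (2 := Nat.le_trans _ _ _ H1 (Nat.lt_le_incl _ _ Hl)) (4 := Hd'); auto.
Qed.

End Decoding.

(** * The decoder *)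

Lemma computable_family o (F : nat -> nat -> nat) N :
  (forall r, computable1 o (F r)) ->
  exists G, computable2 o G /\ forall r, r < N -> forall k, G r k = F r k.
Proof.
  intros HF; induction N as [|N (G & HG & HGF)].
  - exists (fun _ _ => 0); split; [ unfold computable2; comp | intros; lia ].
  - pose proof (HF N) as HN.
    (* Merging finitely many programs into one lets a computed index select the real. *)
    exists (fun r k => ifz (dist r N) (F N k) (G r k)); split.
    + unfold computable2; comp.
    + intros r Hr k; destruct (dist r N) eqn:E; simpl.
      * rewrite dist_eq0 in E; now subst.
      * apply HGF; destruct (Nat.eq_dec r N) as [->|]; [ | lia ].
        unfold dist in E; lia.
Qed.

Section DecoderCodes.
Variables (o : nat -> bool) (h : nat -> nat -> nat -> nat) (G : nat -> nat -> nat).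
Hypothesis h_comp : computable3 o h.
Hypothesis G_comp : computable2 o G.

Lemma computable_guess : computable3 o (fun r t s => guess h (G r) t s).
Proof. unfold computable3, guess, disagreement; comp. Qed.

Lemma computable_departed : computable3 o (fun e r u => departed h e (G r) u).
Proof. unfold computable3, departed, disagreement; comp. Qed.

Definition departure_test (d u i st : nat) : nat :=
  departed h (guess h (G (cyc i + d)) (p1 st) (p2 st)) (G (cyc i + d)) u.

Lemma computable_departure_test d : computable3 o (departure_test d).
Proof.
  pose proof computable_guess as Hg; pose proof computable_departed as Hd.
  apply (computable_app3 o (fun e r u => departed h e (G r) u)); [ exact Hd | | comp | comp ].
  apply (computable_app3 o (fun r t s => guess h (G r) t s)); [ exact Hg | comp | comp | comp ].
Qed.

Lemma eval_departure d : exists c, forall i st u,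
  departs_at h (G (cyc i + d)) (p1 st) (p2 st) u -> eval o c [i; st] u.
Proof.
  destruct (computable_departure_test d) as [c Hc].
  exists (Mu c); intros i st u [H0 HS]; constructor.
  - rewrite <- H0; apply (Hc [u; i; st] eq_refl).
  - intros m Hm; apply HS in Hm.
    exists (pred (departure_test d m i st)).
    replace (S (pred _)) with (departure_test d m i st)
      by (unfold departure_test; lia).
    apply (Hc [m; i; st] eq_refl).
Qed.

End DecoderCodes.

(* Iterating the decoder is a primitive recursion whose steps are unbounded searches, so it
   need not be total: it is only run on a sequence along which the searches succeed. *)
Lemma decoder o h (G : nat -> nat -> nat) t0 (s u : nat -> nat) (y : nat -> bool) :
  computable3 o h -> computable2 o G ->
  (forall i, let t := match i with 0 => t0 | S j => s j end in
     departs_at h (G (cyc i)) t (s i) (s (S i)) /\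
     departs_at h (G (cyc i + 3)) t (s i) (u i) /\
     (s (S i) < u i <-> y i = true)) ->
  turing_le y o.
Proof.
  intros Hh HG Hdep.
  destruct (eval_departure o h G Hh HG 0) as [c0 H0].
  destruct (eval_departure o h G Hh HG 3) as [c3 H3].
  destruct (computable_const o 0 (pr t0 (s 0))) as [cI HI].
  assert (HP : computable2 o (fun st u => pr (p2 st) u)) by (unfold computable2; comp).
  destruct HP as [cP HP].
  assert (HL : computable2 o (fun a b => 1 - (S a - b))) by (unfold computable2; comp).
  destruct HL as [cL HL].
  (* [R] computes the current pair of bounds: each round keeps the second one and appends the
     departure time found by [c0]. *)
  set (R := Prec cI (Comp cP [Proj 1; c0])).
  set (bound i := match i with 0 => t0 | S j => s j end).
  assert (E0 : forall i, eval o c0 [i; pr (bound i) (s i)] (s (S i))).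
  { intros i; apply H0; rewrite p1_pr, p2_pr, Nat.add_0_r; apply (Hdep i). }
  assert (E3 : forall i, eval o c3 [i; pr (bound i) (s i)] (u i)).
  { intros i; apply H3; rewrite p1_pr, p2_pr; apply (Hdep i). }
  assert (ER : forall i, eval o R [i] (pr (bound i) (s i))).
  { induction i as [|i IH]; [ constructor; apply (HI [] eq_refl) | ].
    econstructor; [ exact IH | ].
    econstructor.
    - econstructor; [ constructor; simpl; lia | ].
      econstructor; [ apply E0 | constructor ].
    - simpl nth; replace (pr (bound (S i)) (s (S i))) with
        (pr (p2 (pr (bound i) (s i))) (s (S i))) by (now rewrite p2_pr).
      apply (HP [_; _] eq_refl). }
  exists (Comp cL [Comp c0 [Proj 0; R]; Comp c3 [Proj 0; R]]); intros i.
  assert (EA : evals o [Proj 0; R] [i] [i; pr (bound i) (s i)]).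
  { econstructor; [ apply (eProj o 0 [i]); simpl; lia | ].
    econstructor; [ apply ER | constructor ]. }
  econstructor.
  - econstructor; [ econstructor; [ exact EA | apply E0 ] | ].
    econstructor; [ econstructor; [ exact EA | apply E3 ] | constructor ].
  - replace (b2n (y i)) with (1 - (S (s (S i)) - u i)).
    + apply (HL [_; _] eq_refl).
    + destruct (Hdep i) as (_ & _ & Hy); destruct (y i); simpl b2n.
      * assert (s (S i) < u i) by now apply Hy. lia.
      * assert (~ s (S i) < u i) by (intros H; apply Hy in H; discriminate). lia.
Qed.

Lemma computes_above_perfect_set (A : (nat -> bool) -> Prop) (b : nat -> nat -> bool) X y :
  closed_set A -> (forall i, A (b i)) ->
  (forall i n, exists j m, n <= m /\ agree_upto m (b i) (b j) /\ b i m <> b j m) ->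
  (forall i, turing_le (b i) X) ->
  exists z : nat -> nat -> bool, (forall r, A (z r)) /\
    forall o, turing_le X o -> (forall r, turing_le (z r) o) -> turing_le y o.
Proof.
  intros HA HbA Hbr HX.
  destruct (coding (halts X) (halts_mono X) b) with (A := A) (y := y)
    as (z & t0 & s & u & Hz & Hdep); auto.
  { intros i; apply halts_complete, HX. }
  exists z; split; auto; intros o Ho Hzo.
  destruct (computable_family o (fun r => nat_of (z r)) 6) as (G & HG & HGz).
  { intros r; apply computable_turing_le, Hzo. }
  apply (decoder o (halts X) G t0 s u y); auto using computable_halts.
  intros i t; destruct (Hdep i) as (H1 & H2 & Hy); pose proof (cyc_lt i).
  split; [ | split; auto ].
  - apply departs_at_ext with (z := nat_of (z (cyc i))) (M := t + s (S i)); auto; try lia.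
    intros; symmetry; apply HGz; lia.
  - apply departs_at_ext with (z := nat_of (z (cyc i + 3))) (M := t + u i); auto; try lia.
    intros; symmetry; apply HGz; lia.
Qed.

(** * The partial order *)

Definition real : Type := nat -> bool.

Inductive poset : Type :=
| Bottom (r : real)
| Middle (g : nat -> real)
| Top (w : nat -> real).

(** A [Middle] is an enumeration rather than a set of points. The even entries of [w] determine the
    only [Middle] below [Top w], and the odd ones are its further points. *)
Definition poset_le (p q : poset) : Prop :=
  match p, q with
  | Bottom r, Bottom r' => r = r'
  | Bottom r, Middle g => exists i, g i = r
  | Bottom r, Top w => exists i, w i = r
  | Middle g, Middle g' => g = g'
  | Middle g, Top w => g = (fun i => w (2 * i))
  | Top w, Top w' => w = w'
  | _, _ => False
  end.

Lemma poset_partial_order : partial_order poset_le.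
Proof.
  split; [ intros []; reflexivity | split ].
  - intros [] []; simpl; intros; subst; auto; contradiction.
  - intros [] [] []; simpl; intros H1 H2; subst; auto; try contradiction.
    destruct H1 as [i Hi]; eauto.
Qed.

Lemma countable_enumerated {T : Type} (Q : T -> Prop) (f : nat -> T) :
  (forall x, Q x -> exists n, f n = x) -> countable_set Q.
Proof.
  intros H.
  assert (g : forall x, {n | Q x -> f n = x}).
  { intros x; apply constructive_indefinite_description.
    destruct (classic (Q x)) as [Hx|]; [ | exists 0; tauto ].
    destruct (H x Hx) as [n Hn]; eauto. }
  exists (fun x => proj1_sig (g x)); intros x x' Hx Hx' E.
  rewrite <- (proj2_sig (g x) Hx), <- (proj2_sig (g x') Hx'); congruence.
Qed.

Lemma poset_locally_countable : locally_countable poset_le.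
Proof.
  intros [r|g|w].
  - apply countable_enumerated with (fun _ => Bottom r).
    intros [] [H Hne]; simpl in H; try contradiction; subst; tauto.
  - apply countable_enumerated with (fun i => Bottom (g i)).
    intros [] [H Hne]; simpl in H; try contradiction; [ | subst; tauto ].
    destruct H as [i <-]; eauto.
  - apply countable_enumerated with
      (fun n => match n with 0 => Middle (fun i => w (2 * i)) | S i => Bottom (w i) end).
    intros [] [H Hne]; simpl in H; try contradiction.
    + destruct H as [i <-]; exists (S i); reflexivity.
    + exists 0; now subst.
    + subst; tauto.
Qed.

Definition rows (r : real) : nat -> real := fun i j => r (Cantor.to_nat (i, j)).

Lemma rows_inj r s : rows r = rows s -> r = s.
Proof.
  intros H; apply functional_extensionality; intros n.
  rewrite <- (Cantor.cancel_to_of n); destruct (Cantor.of_nat n) as [i j].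
  change (rows r i j = rows s i j); now rewrite H.
Qed.

Lemma rows_surj g : exists r, rows r = g.
Proof.
  exists (fun n => g (fst (Cantor.of_nat n)) (snd (Cantor.of_nat n))).
  apply functional_extensionality; intros i; apply functional_extensionality; intros j.
  unfold rows; now rewrite Cantor.cancel_of_to.
Qed.

Definition scons (a : bool) (r : real) : real :=
  fun n => match n with 0 => a | S n => r n end.

Lemma scons_eta r : scons (r 0) (fun n => r (S n)) = r.
Proof. apply functional_extensionality; intros [|n]; reflexivity. Qed.

Lemma poset_size : size_continuum (fun _ : poset => True).
Proof.
  (* The prefixes 0, 10 and 11 select the constructor. *)
  set (F := fun r : real =>
    if r 0 then
      if r 1 then Top (rows (fun n => r (S (S n)))) else Middle (rows (fun n => r (S (S n))))
    else Bottom (fun n => r (S n))).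
  exists F; split; [ auto | split ].
  - unfold F; intros r s.
    assert (H : r 0 = s 0 -> (fun n => r (S n)) = (fun n => s (S n)) -> r = s).
    { intros H1 H2; rewrite <- (scons_eta r), <- (scons_eta s); congruence. }
    assert (H' : r 0 = s 0 -> r 1 = s 1 ->
       (fun n => r (S (S n))) = (fun n => s (S (S n))) -> r = s).
    { intros H1 H2 H3; apply H; auto.
      rewrite <- (scons_eta (fun n => r (S n))), <- (scons_eta (fun n => s (S n))); congruence. }
    destruct (r 0), (s 0); try destruct (r 1); try destruct (s 1); intros E;
      try discriminate; injection E as E; auto; apply H'; auto; now apply rows_inj.
  - intros [r|g|w] _.
    + exists (scons false r); reflexivity.
    + destruct (rows_surj g) as [r <-]; exists (scons true (scons false r)); reflexivity.
    + destruct (rows_surj w) as [r <-]; exists (scons true (scons true r)); reflexivity.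
Qed.

Lemma first_level_Bottom p : first_level poset_le p <-> exists r, p = Bottom r.
Proof.
  split.
  - intros H; destruct p as [r|g|w]; eauto; exfalso.
    + apply (H (Bottom (g 0))); split; [ simpl; eauto | discriminate ].
    + apply (H (Bottom (w 0))); split; [ simpl; eauto | discriminate ].
  - intros [r ->] [] [H Hne]; simpl in H; try contradiction; subst; tauto.
Qed.

Lemma poset_height : height3 poset_le.
Proof.
  set (w := fun (_ _ : nat) => true); split.
  - exists (Bottom (w 0)), (Middle w), (Top w).
    repeat split; try discriminate; exists 0; reflexivity.
  - set (rank := fun p => match p with Bottom _ => 0 | Middle _ => 1 | Top _ => 2 end).
    assert (H : forall p q, lt_of poset_le p q -> rank p < rank q).
    { intros [] [] [H Hne]; simpl in *; try lia; try contradiction; subst; tauto. }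
    intros (a & b & c & d & H1 & H2 & H3); apply H in H1, H2, H3.
    destruct d; simpl in *; lia.
Qed.

Lemma first_level_size : size_continuum (first_level poset_le).
Proof.
  exists Bottom; split; [ | split ].
  - intros r; apply first_level_Bottom; eauto.
  - intros r s E; now injection E.
  - intros x Hx; apply first_level_Bottom in Hx; destruct Hx as [r ->]; eauto.
Qed.

(** * Countable dense subsets of perfect sets *)

Fixpoint bits (l n : nat) : list bool :=
  match l with
  | 0 => []
  | S l => Nat.odd n :: bits l (Nat.div2 n)
  end.

Lemma bits_surj (x : real) n :
  exists c, forall k, k < n -> nth k (bits n c) false = x k.
Proof.
  revert x; induction n as [|n IH]; intros x; [ exists 0; intros; lia | ].
  destruct (IH (fun k => x (S k))) as [c Hc].
  exists (b2n (x 0) + 2 * c).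
  assert (E : Nat.odd (b2n (x 0) + 2 * c) = x 0 /\ Nat.div2 (b2n (x 0) + 2 * c) = c).
  { destruct (x 0); simpl b2n.
    - split; [ apply Nat.odd_spec; exists c; lia | apply (Nat.div2_succ_double c) ].
    - split; [ rewrite <- Nat.negb_even; apply Bool.negb_false_iff, Nat.even_spec;
               exists c; lia | apply (Nat.div2_double c) ]. }
  destruct E as [E1 E2]; cbn [bits]; rewrite E1, E2.
  intros [|k] Hk; [ reflexivity | simpl; apply Hc; lia ].
Qed.

Lemma countable_dense_subset (A : real -> Prop) :
  (exists x, A x) ->
  exists b : nat -> real, (forall i, A (b i)) /\
    forall x n, A x -> exists i, agree_upto n x (b i).
Proof.
  intros [x0 Hx0].
  (* [i] codes a finite string by its length and its binary value; a point of [A] extending it is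
     chosen whenever there is one. *)
  set (Q := fun i x => A x /\ forall k, k < p1 i ->
              nth k (bits (p1 i) (p2 i)) false = x k).
  assert (H : forall i, {x | A x /\ ((exists x', Q i x') -> Q i x)}).
  { intros i; apply constructive_indefinite_description.
    destruct (classic (exists x', Q i x')) as [[x' Hx']|N].
    - exists x'; split; auto; apply Hx'.
    - exists x0; tauto. }
  exists (fun i => proj1_sig (H i)); split; [ intros i; exact (proj1 (proj2_sig (H i))) | ].
  intros x n Hx; destruct (bits_surj x n) as [c Hc]; exists (pr n c).
  destruct (proj2_sig (H (pr n c))) as [_ HQ].
  destruct HQ as [_ HQ].
  - exists x; split; auto; now rewrite p1_pr, p2_pr.
  - rewrite p1_pr, p2_pr in HQ; intros k Hk.
    rewrite <- HQ, Hc; auto.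
Qed.

Lemma first_difference (x y : real) :
  x <> y -> exists m, agree_upto m x y /\ x m <> y m.
Proof.
  intros H; destruct (least_nat (fun m => x m <> y m)) as (m & Hm & Hmin).
  - apply not_all_ex_not; intros E; apply H, functional_extensionality, E.
  - exists m; split; auto; intros k Hk; apply Hmin in Hk; now apply NNPP in Hk.
Qed.

(** A point of [A] close to [b i] but different from it is approximated by some [b j] past their
    first difference. *)
Lemma dense_branching (A : real -> Prop) (b : nat -> real) :
  no_isolated A -> (forall i, A (b i)) ->
  (forall x n, A x -> exists i, agree_upto n x (b i)) ->
  forall i n, exists j m, n <= m /\ agree_upto m (b i) (b j) /\ b i m <> b j m.
Proof.
  intros Hiso HbA Hd i n.
  destruct (Hiso (b i) (HbA i) n) as (x & Hx & Hne & Hag).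
  destruct (first_difference (b i) x) as (m & Hm & Hdiff); [ congruence | ].
  destruct (Hd x (S m) Hx) as [j Hj]; exists j, m; repeat split.
  - destruct (Nat.le_gt_cases n m) as [|Hlt]; auto; now apply Hag in Hlt.
  - intros k Hk; rewrite Hm by auto; apply Hj; lia.
  - rewrite <- (Hj m) by lia; auto.
Qed.

(** The oracle [z] simulates the machine with oracle [y]: [Mu] searches for a halting time, then the
    output is read off. *)
Lemma turing_le_trans x y z : turing_le x y -> turing_le y z -> turing_le x z.
Proof.
  intros Hxy Hyz; destruct (halts_complete y x Hxy) as [e He].
  pose proof (computable_halts y z Hyz) as Hh.
  assert (HT : computable2 z (fun s k => 1 - halts y e k s)) by (unfold computable2; comp).
  assert (HO : computable2 z (fun k s => pred (halts y e k s))) by (unfold computable2; comp).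
  destruct HT as [cT HT], HO as [cO HO].
  exists (Comp cO [Proj 0; Mu cT]); intros k.
  destruct (least_nat (fun s => halts y e k s <> 0)) as (s & Hs & Hmin).
  { destruct (He k) as [s Hs]; exists s; congruence. }
  econstructor.
  - econstructor; [ apply (eProj z 0 [k]); simpl; lia | ].
    econstructor; [ | constructor ].
    apply (eMu z cT [k] s).
    + replace 0 with (1 - halts y e k s) by lia; apply (HT [s; k] eq_refl).
    + intros m Hm; exists 0; apply Hmin, NNPP in Hm.
      replace 1 with (1 - halts y e k m) by lia; apply (HT [m; k] eq_refl).
  - replace (b2n (x k)) with (pred (halts y e k s)); [ apply (HO [k; s] eq_refl) | ].
    destruct (He k) as [s' Hs'].
    destruct (halts y e k s) as [|n] eqn:E; [ congruence | ].
    apply (halts_mono _ _ _ _ (s + s')) in E, Hs'; lia.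
Qed.

(** * Refuting an embedding *)

Lemma poset_no_embedding (f : poset -> real) (A : real -> Prop) :
  perfect_set A ->
  (forall a, A a -> exists p, first_level poset_le p /\ turing_eq a (f p)) ->
  ~ turing_embedding poset_le f.
Proof.
  intros (Hne & Hcl & Hiso) HAf Hf.
  destruct (countable_dense_subset A Hne) as (b & HbA & Hd).
  assert (HP : forall a, A a -> exists r, turing_eq a (f (Bottom r))).
  { intros a Ha; destruct (HAf a Ha) as (p & Hp & Hap).
    apply first_level_Bottom in Hp; destruct Hp as [r ->]; eauto. }
  assert (Hpi : forall x : nat -> real, (forall i, A (x i)) ->
    exists g, forall i, turing_eq (x i) (f (Bottom (g i)))).
  { intros x Hx.
    exists (fun i => proj1_sig (constructive_indefinite_description _ (HP _ (Hx i)))).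
    intros i; apply (proj2_sig (constructive_indefinite_description _ (HP _ (Hx i)))). }
  destruct (Hpi b HbA) as [g Hg].
  (* Any sequence other than [g] would do: the real to be coded is the image of a different
     [Middle]. *)
  set (g' := fun (_ n : nat) => negb (g 0 n)).
  destruct (computes_above_perfect_set A b (f (Middle g)) (f (Middle g')))
    as (z & HzA & Hz); auto.
  { apply dense_branching with A; auto. }
  { intros i; apply turing_le_trans with (f (Bottom (g i))); [ apply Hg | ].
    apply Hf; exists i; reflexivity. }
  destruct (Hpi z HzA) as [q Hq].
  (* Interleaving puts [Top w] above [Middle g] and above the points whose images have the degrees
     of the coding reals. *)
  set (w := fun i => if Nat.even i then g (Nat.div2 i) else q (Nat.div2 i)).
  assert (Hwe : (fun i => w (2 * i)) = g).
  { apply functional_extensionality; intros i; unfold w.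
    rewrite Nat.even_mul, Nat.div2_double; reflexivity. }
  assert (Hwo : forall i, w (S (2 * i)) = q i).
  { intros i; unfold w.
    rewrite Nat.even_succ, <- Nat.negb_even, Nat.even_mul, Nat.div2_succ_double; reflexivity. }
  assert (Hle : poset_le (Middle g') (Top w)).
  { apply Hf, Hz.
    - apply Hf; simpl; now symmetry.
    - intros r; apply turing_le_trans with (f (Bottom (q r))); [ apply Hq | ].
      apply Hf; exists (S (2 * r)); apply Hwo. }
  (* The only [Middle] below [Top w] is [Middle g], so [g'] would equal [g]. *)
  change (g' = (fun i => w (2 * i))) in Hle; rewrite Hwe in Hle.
  assert (E : g' 0 0 = g 0 0) by now rewrite Hle.
  unfold g' in E; destruct (g 0 0); discriminate.
Qed.

Theorem theorem1p2 :
  exists (P : Type) (le : P -> P -> Prop),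
    partial_order le /\
    locally_countable le /\
    size_continuum (fun _ : P => True) /\
    height3 le /\
    size_continuum (first_level le) /\
    (forall f : P -> nat -> bool,
        (exists A : (nat -> bool) -> Prop,
            perfect_set A /\
            forall a, A a -> exists p, first_level le p /\ turing_eq a (f p)) ->
        ~ turing_embedding le f).
Proof.
  exists poset, poset_le.
  split; [ exact poset_partial_order | ].
  split; [ exact poset_locally_countable | ].
  split; [ exact poset_size | ].
  split; [ exact poset_height | ].
  split; [ exact first_level_size | ].
  intros f (A & HA & HAf); now apply poset_no_embedding with A.
Qed.
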